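(* Let $G$ be a finite simple bipartite graph without isolated vertices. Then $\operatorname{ord-match}(G)=\operatorname{ind-match}(G)=1$ if and only if $G$ is a complete bipartite graph $K_{m,n}$ for some $m,n\ge 1$.
   Context: Graphs have non-empty vertex set. A matching in $G$ is a set of pairwise disjoint edges. An induced matching is a matching such that no two of its edges are joined by an edge of $G$; $\operatorname{ind-match}(G)$ is the largest size of an induced matching. An ordered matching is a matching whose edges can be written as $a_1b_1,\dots,a_rb_r$ (for some ordering of the edges and some choice of endpoints) such that $\{a_1,\dots,a_r\}$ is an independent set of $G$ and $a_ib_j\in E(G)$ implies $i\le j$; $\operatorname{ord-match}(G)$ is the largest size of an ordered matching. *)

(* Defs.v *)
From mathcomp Require Import all_boot.

Set Implicit Arguments.
Unset Strict Implicit.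
Unset Printing Implicit Defensive.

(* The vertex type may be empty here; non-emptiness is assumed where needed. *)
Record sgraph := SGraph {
  vertex :> finType;
  adj : rel vertex;
  adj_sym : symmetric adj;
  adj_irrefl : irreflexive adj
}.

Arguments adj {s}.

Section Graph.
Variable G : sgraph.

Definition edges : {set {set G}} :=
  [set [set p.1; p.2] | p : G * G & adj p.1 p.2].

Definition independent (A : {set G}) : bool :=
  [forall x in A, forall y in A, ~~ adj x y].

Definition bipartite : Prop :=
  exists A B : {set G},
    [/\ A :|: B = [set: G], [disjoint A & B], independent A & independent B].

Definition no_isolated_vertex : Prop := forall x : G, exists y : G, adj x y.

Definition matching (M : {set {set G}}) : bool :=
  (M \subset edges) && trivIset M.

Definition joined (e f : {set G}) : bool :=
  [exists x in e, exists y in f, adj x y].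

Definition induced_matching (M : {set {set G}}) : bool :=
  matching M && [forall e in M, forall f in M, (e != f) ==> ~~ joined e f].

(* As 'I_#|M| and M have the same size, the equation on M makes
   i |-> [set a i; b i] an enumeration of M without repetition. *)
Definition ordered_matching (M : {set {set G}}) : bool :=
  matching M &&
  [exists a : {ffun 'I_#|M| -> G}, exists b : {ffun 'I_#|M| -> G},
    [&& M == [set [set a i; b i] | i : 'I_#|M|],
        independent [set a i | i : 'I_#|M|]
      & [forall i, forall j, adj (a i) (b j) ==> (i <= j)]]].

Definition ind_match : nat :=
  \max_(M : {set {set G}} | induced_matching M) #|M|.

Definition ord_match : nat :=
  \max_(M : {set {set G}} | ordered_matching M) #|M|.

End Graph.

Definition Kadj (m n : nat) : rel ('I_m + 'I_n)%type :=
  fun u v => match u, v with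
             | inl _, inr _ | inr _, inl _ => true
             | _, _ => false
             end.

Lemma Kadj_sym m n : symmetric (@Kadj m n).
Proof. by move=> [?|?] [?|?]. Qed.

Lemma Kadj_irrefl m n : irreflexive (@Kadj m n).
Proof. by move=> [?|?]. Qed.

Definition complete_bipartite (m n : nat) : sgraph :=
  SGraph (@Kadj_sym m n) (@Kadj_irrefl m n).

Definition isomorphic (G H : sgraph) : Prop :=
  exists f : G -> H, bijective f /\ forall x y : G, adj (f x) (f y) = adj x y.

(* Main.v *)
Require Import Defs.
From mathcomp Require Import all_boot.

(** For a bipartite graph without isolated vertices, being complete bipartite
    means that adjacency is the relation [s x != s y] for some two-colouring
    [s] of the vertices.

    If the parts [A] and [B] contain non-adjacent vertices [x \in A] and
    [y \in B], choose neighbours [x'] of [x] and [y'] of [y].  The edges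
    [y' y], [x x'], in this order and with [y'] and [x] as first endpoints,
    form an ordered matching of size 2: both first endpoints lie in [A], and
    [x] is not adjacent to [y].  Hence [ord_match G = 1] already makes [G]
    complete bipartite.

    Conversely, suppose that adjacency is [s x != s y].  Any two edges are
    joined, so an induced matching has at most one edge.  In an ordered
    matching the independent vertices [a i] all have the same colour and the
    [b i] the other one, so every [a i] is adjacent to every [b j], which
    forces all indices to coincide.  A single edge shows that both invariants
    are at least 1. *)

Set Implicit Arguments.
Unset Strict Implicit.
Unset Printing Implicit Defensive.

Section Matchings.
Variable G : sgraph.
Implicit Types (x y : G) (s : pred G).

Lemma edgesP (e : {set G}) :
  reflect (exists x y, adj x y /\ e = [set x; y]) (e \in edges G).
Proof.
apply: (iffP imsetP) => [[[x y] /= xy ->]|[x [y [xy ->]]]].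
  by exists x, y; split; first by rewrite inE in xy.
by exists (x, y); rewrite ?inE.
Qed.

Lemma edges_adj x y : ([set x; y] \in edges G) = adj x y.
Proof.
apply/edgesP/idP => [[u [v [uv E]]]|xy]; last by exists x, y.
have : u \in [set x; y] by rewrite E set21.
have : v \in [set x; y] by rewrite E set22.
rewrite !inE => /orP[]/eqP vE /orP[]/eqP uE; move: uv; rewrite uE vE //.
- by rewrite adj_irrefl.
- by rewrite adj_sym.
- by rewrite adj_irrefl.
Qed.

(** The distinctness of the vertices [a i], [b j] need not be assumed: it
    follows from the adjacency conditions. *)
Lemma leq_ord_match r (a b : 'I_r -> G) :
    (forall i, adj (a i) (b i)) -> (forall i j, ~~ adj (a i) (a j)) ->
    (forall i j, adj (a i) (b j) -> i <= j) ->
  r <= ord_match G.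
Proof.
move=> ab aa le_ab.
have a_inj i j : a i = a j -> i = j.
  move=> E; apply/val_inj/eqP; rewrite eqn_leq.
  by rewrite !le_ab // ?E // -E.
have b_inj i j : b i = b j -> i = j.
  move=> E; apply/val_inj/eqP; rewrite eqn_leq.
  by rewrite !le_ab // ?E // -E.
have abN i j : a i <> b j by move=> E; have := aa j i; rewrite E ab.
have meet i j x : x \in [set a i; b i] -> x \in [set a j; b j] -> i = j.
  rewrite !inE => /orP[]/eqP-> /orP[]/eqP E.
  - exact: a_inj.
  - by case: (abN _ _ E).
  - by case: (abN _ _ (esym E)).
  - exact: b_inj.
have e_inj : injective (fun i => [set a i; b i]).
  by move=> i j E; apply: (meet i j (a i)); rewrite -?E set21.
pose M := [set [set a i; b i] | i : 'I_r].
have cardM : #|M| = r by rewrite card_imset // card_ord.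
rewrite -{1}cardM.
apply: (@leq_bigmax_cond _ (@ordered_matching G) (fun M => #|M|)).
apply/andP; split.
  apply/andP; split.
    by apply/subsetP=> _ /imsetP[i _ ->]; rewrite edges_adj.
  apply/trivIsetP=> _ _ /imsetP[i _ ->] /imsetP[j _ ->] ne.
  apply/pred0P=> x; apply/negP=> /andP[/= xi xj].
  by rewrite (meet _ _ _ xi xj) eqxx in ne.
apply/existsP; exists [ffun i => a (cast_ord cardM i)].
apply/existsP; exists [ffun i => b (cast_ord cardM i)].
apply/and3P; split.
- apply/eqP/setP=> e; apply/imsetP/imsetP=> [[i _ ->]|[i _ ->]].
    by exists (cast_ord (esym cardM) i); rewrite // !ffunE cast_ordKV.
  by exists (cast_ord cardM i); rewrite // !ffunE.
- apply/forall_inP=> _ /imsetP[i _ ->]; apply/forall_inP=> _ /imsetP[j _ ->].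
  by rewrite !ffunE aa.
- by apply/forallP=> i; apply/forallP=> j; rewrite !ffunE; apply/implyP=> /le_ab.
Qed.

Lemma ord_match_gt0 x y : adj x y -> 0 < ord_match G.
Proof.
move=> xy; apply: (@leq_ord_match 1 (fun=> x) (fun=> y)) => // [_ _|i j _].
  by rewrite adj_irrefl.
by rewrite !ord1.
Qed.

(** The ordered matching is [y' y], [x x'], with first endpoints [y'] and [x]. *)
Lemma ord_match_gt1 x x' y y' :
    adj x x' -> adj y' y -> ~~ adj x y' -> ~~ adj x y ->
  1 < ord_match G.
Proof.
move=> xx' y'y xy' xy.
have y'x : ~~ adj y' x by rewrite adj_sym.
apply: (@leq_ord_match 2 (fun i => if i == ord0 then y' else x)
                         (fun i => if i == ord0 then y else x')).
- by move=> i; case: ifP.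
- by move=> i j; do 2!case: ifP => _; rewrite ?adj_irrefl.
- case=> [[|[|//]] ?] [[|[|//]] ?] //=.
  by rewrite (negPf xy).
Qed.

Lemma ind_match_gt0 x y : adj x y -> 0 < ind_match G.
Proof.
move=> xy; rewrite -(cards1 [set x; y]).
apply: (@leq_bigmax_cond _ (@induced_matching G) (fun M => #|M|)).
apply/andP; split.
  by rewrite /matching sub1set edges_adj xy trivIset1.
apply/forall_inP=> e /set1P->; apply/forall_inP=> f /set1P->.
by rewrite eqxx.
Qed.

Lemma ord_match_le1 s :
  (forall x y, adj x y = (s x != s y)) -> ord_match G <= 1.
Proof.
move=> adjE; apply/bigmax_leqP=> M /andP[/andP[/subsetP ME _]].
move=> /existsP[a /existsP[b /and3P[/eqP defM indep /forallP le_ab]]].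
rewrite leqNgt; apply/negP=> M_gt1.
pose i := Ordinal (ltnW M_gt1); pose j := Ordinal M_gt1.
have ab : adj (a i) (b i).
  by rewrite -edges_adj; apply: ME; have /setP-> := defM; apply: imset_f.
(* Independence gives [a i] and [a j] the same colour; then [a j] is adjacent
   to [b i] although [i < j]. *)
have /forall_inP/(_ (a j) (imset_f _ isT)) :=
  forall_inP indep (a i) (imset_f _ isT).
have /implyP := forallP (le_ab j) i.
move: ab; rewrite !adjE negbK => ab + /eqP aij.
by rewrite -aij => /(_ ab).
Qed.

Lemma ind_match_le1 s :
  (forall x y, adj x y = (s x != s y)) -> ind_match G <= 1.
Proof.
move=> adjE; apply/bigmax_leqP=> M /andP[/andP[/subsetP ME _] indM].
rewrite leqNgt; apply/negP=> /card_gt1P[e [f [eM fM ef]]].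
have := forall_inP (forall_inP indM e eM) f fM; rewrite ef /= => /negP; apply.
have /edgesP[x [y [xy ->]]] := ME _ eM.
have /edgesP[u [v [uv ->]]] := ME _ fM.
apply/exists_inP; exists x; rewrite ?set21 //; apply/exists_inP.
have [xu|xu] := boolP (adj x u); first by exists u; rewrite ?set21.
exists v; rewrite ?set22 //; move: xu uv.
by rewrite !adjE negbK => /eqP->.
Qed.

Lemma complete_bipartite_colouring m n :
    isomorphic G (complete_bipartite m n) ->
  exists s, forall x y, adj x y = (s x != s y).
Proof.
case=> f [_ fadj]; exists (fun x => if f x is inl _ then true else false).
by move=> x y; rewrite -fadj; case: (f x) (f y) => [?|?] [?|?].
Qed.

Lemma colouring_complete_bipartite (A : {set G}) x0 y0 :
    x0 \in A -> y0 \in ~: A ->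
    (forall x y, adj x y = ((x \in A) != (y \in A))) ->
  isomorphic G (complete_bipartite #|A| #|~: A|).
Proof.
move=> Ax0 Ay0 adjE.
pose f x : complete_bipartite #|A| #|~: A| :=
  if x \in A then inl (enum_rank_in Ax0 x) else inr (enum_rank_in Ay0 x).
exists f; split; last first.
  by move=> x y; rewrite adjE /f; case: (x \in A); case: (y \in A).
apply: inj_card_bij; last by rewrite card_sum !card_ord cardsC.
move=> x y; rewrite /f; case: ifP => Ax; case: ifP => Ay // [].
  exact: enum_rank_in_inj.
by apply: enum_rank_in_inj; rewrite inE ?Ax ?Ay.
Qed.

End Matchings.

Theorem theorem3p4 (G : sgraph) (G_nonempty : 0 < #|G|)
    (G_bipartite : bipartite G) (G_no_isolated : no_isolated_vertex G) :
  (ord_match G = 1 /\ ind_match G = 1) <->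
  (exists m n : nat,
     [/\ 1 <= m, 1 <= n & isomorphic G (complete_bipartite m n)]).
Proof.
have [x0 _] := card_gt0P G_nonempty.
have [y0 xy0] := G_no_isolated x0.
split=> [[ord1 _]|[m [n [_ _ /complete_bipartite_colouring[s adjE]]]]]; last first.
  split; apply/eqP; rewrite eqn_leq.
    by rewrite (ord_match_le1 adjE) (ord_match_gt0 xy0).
  by rewrite (ind_match_le1 adjE) (ind_match_gt0 xy0).
have [A [B [AB_cover AB_disj indA indB]]] := G_bipartite.
have defB : B = ~: A.
  apply/setP=> x; rewrite inE; have := in_setT x; rewrite -AB_cover inE.
  by case: (boolP (x \in A)) => [/(disjointFr AB_disj)|].
have sameA x y : x \in A -> y \in A -> ~~ adj x y.
  by move=> xA; apply: (forall_inP (forall_inP indA x xA)).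
have sameB x y : x \notin A -> y \notin A -> ~~ adj x y.
  by move=> xA yA; apply: (forall_inP (forall_inP indB x _)); rewrite defB inE.
have cross x y : x \in A -> y \notin A -> adj x y.
  move=> xA yA; apply: contraT => xy.
  have [x' xx'] := G_no_isolated x; have [y' yy'] := G_no_isolated y.
  have y'A : y' \in A by apply: contraLR yy'; apply: sameB.
  rewrite adj_sym in yy'.
  by have := ord_match_gt1 xx' yy' (sameA _ _ xA y'A) xy; rewrite ord1.
have adjE x y : adj x y = ((x \in A) != (y \in A)).
  case: (boolP (x \in A)) => xA; case: (boolP (y \in A)) => yA /=.
  - exact/negbTE/sameA.
  - exact: cross.
  - by rewrite adj_sym cross.
  - exact/negbTE/sameB.
(* The edge [x0 y0] has one endpoint in each part, so both are non-empty. *)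
have [u [v [uA vA]]] : exists u v, u \in A /\ v \in ~: A.
  move: xy0; rewrite adjE.
  case: (boolP (x0 \in A)) => x0A; case: (boolP (y0 \in A)) => y0A //= _.
    by exists x0, y0; rewrite inE.
  by exists y0, x0; rewrite inE.
exists #|A|, #|~: A|; split.
- by apply/card_gt0P; exists u.
- by apply/card_gt0P; exists v.
- exact: colouring_complete_bipartite uA vA adjE.
Qed.
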